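(* Let $\geq$ be the relation on the set of acts $X^S$ defined by $f\geq g\Leftrightarrow N([f\geq g])\geq N([g\geq f])$, where $N$ is a necessity function on $2^S$. Then for all $A,B\subseteq S$ and all $x,y,x',y'\in X$ with $x>y$ and $x'>y'$, $$\omega(A)^{x,y}\geq\omega(B)^{x,y}\iff\omega(A)^{x',y'}\geq\omega(B)^{x',y'}.$$
   Context: $S$ is a finite set of states; $X$ is a set of consequences with a total preorder $\geq_P$ (complete, transitive) having at least two elements $x,y$ with $x>_P y$. An act is a map $f:S\to X$. For acts $f,g$: $[f\geq g]=\{s\in S:f(s)\geq_P g(s)\}$. A necessity function is a map $N:2^S\to[0,1]$ with $N(F\cap G)=\min(N(F),N(G))$ for all $F,G\subseteq S$ and $N(S)>N(\emptyset)$. For $x,y\in X$, $x\geq y$ means $f_x\geq f_y$ where $f_x,f_y$ are the constant acts, and $x>y$ means $x\geq y$ and not $y\geq x$. For $C\subseteq S$ and $x>y$ in $X$, $\omega(C)^{x,y}$ is the act with value $x$ on $C$ and $y$ on $S\setminus C$. *)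

(* Defs.v *)
From mathcomp Require Import all_boot all_order all_algebra.
From mathcomp Require Import reals.

Set Implicit Arguments.
Unset Strict Implicit.
Unset Printing Implicit Defensive.

Import Order.TTheory GRing.Theory Num.Theory.
Local Open Scope ring_scope.

(* [geP x y] reads x >=_P y; [total] is completeness (and gives reflexivity). *)
Definition total_preorder (X : Type) (geP : rel X) : Prop :=
  total geP /\ transitive geP.

Definition nontrivial (X : Type) (geP : rel X) : Prop :=
  exists x y : X, geP x y && ~~ geP y x.

Definition act (S : finType) (X : Type) : Type := S -> X.

Definition const_act (S : finType) (X : Type) (x : X) : act S X := fun=> x.

Definition ge_set (S : finType) (X : Type) (geP : rel X) (f g : act S X) :
    {set S} :=
  [set s | geP (f s) (g s)].

Definition necessity (R : realType) (S : finType) (N : {set S} -> R) : Prop :=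
  [/\ forall F : {set S}, 0 <= N F <= 1,
      forall F G : {set S}, N (F :&: G) = Num.min (N F) (N G)
    & N [set: S] > N set0].

Definition ge_act (R : realType) (S : finType) (X : Type) (geP : rel X)
    (N : {set S} -> R) (f g : act S X) : bool :=
  N (ge_set geP f g) >= N (ge_set geP g f).

(* The order on X induced by [ge_act] through constant acts, as opposed to the
   given order [geP]. *)
Definition ge_cons (R : realType) (S : finType) (X : Type) (geP : rel X)
    (N : {set S} -> R) (x y : X) : bool :=
  ge_act geP N (const_act x) (const_act y).

Definition gt_cons (R : realType) (S : finType) (X : Type) (geP : rel X)
    (N : {set S} -> R) (x y : X) : bool :=
  ge_cons geP N x y && ~~ ge_cons geP N y x.

(* Only meant for x > y in the sense of [gt_cons]. *)
Definition omega (S : finType) (X : Type) (C : {set S}) (x y : X) : act S X :=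
  fun s => if s \in C then x else y.

(* Main.v *)
Require Import Defs.
From mathcomp Require Import all_boot all_order all_algebra.
From mathcomp Require Import reals.

Set Implicit Arguments.
Unset Strict Implicit.
Unset Printing Implicit Defensive.

Import Order.TTheory.
Local Open Scope ring_scope.

(** [gt_cons] forces strict [geP]-preference, since [N set0 < N setT]. Between
    two acts with the same strictly ranked values, each preference set is then
    [A :|: ~: B], which no longer mentions these values. *)

Lemma ge_set_const (S : finType) (X : Type) (geP : rel X) (x y : X) :
  ge_set geP (@const_act S X x) (const_act y) =
  if geP x y then [set: S] else set0.
Proof. by apply/setP=> s; rewrite !inE; case: (geP x y); rewrite !inE. Qed.

(** Preference sets of constant acts are full or empty, so equal truth values of [geP x y] and
    [geP y x] would give equal necessities. *)
Lemma gt_cons_geP (R : realType) (S : finType) (X : Type) (geP : rel X)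
    (N : {set S} -> R) (x y : X) :
  N set0 < N [set: S] -> gt_cons geP N x y -> geP x y && ~~ geP y x.
Proof.
move=> N0T /andP[_]; rewrite /ge_cons /ge_act !ge_set_const -ltNge.
case: (geP x y); case: (geP y x) => //; rewrite ?ltxx //.
(* Only [geP y x] holds here, which would give [N [set: S] < N set0]. *)
by move=> /(lt_trans N0T); rewrite ltxx.
Qed.

(** The comparison fails only where [y] meets [x], on [B :\: A]; ties hold by reflexivity. *)
Lemma ge_set_omega (S : finType) (X : Type) (geP : rel X) (A B : {set S})
    (x y : X) :
  reflexive geP -> geP x y -> ~~ geP y x ->
  ge_set geP (omega A x y) (omega B x y) = A :|: ~: B.
Proof.
move=> geP_refl xy /negPf nyx; apply/setP=> s; rewrite !inE /omega.
by case: (s \in A); case: (s \in B); rewrite ?geP_refl ?xy ?nyx.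
Qed.

Theorem mainTheorem5 (R : realType) (S : finType) (X : Type) (geP : rel X)
    (hP : total_preorder geP) (hnt : nontrivial geP)
    (N : {set S} -> R) (hN : necessity N)
    (A B : {set S}) (x y x' y' : X)
    (hxy : gt_cons geP N x y) (hxy' : gt_cons geP N x' y') :
  ge_act geP N (omega A x y) (omega B x y) <->
  ge_act geP N (omega A x' y') (omega B x' y').
Proof.
have [_ _ N0T] := hN.
have geP_refl : reflexive geP by move=> z; have := hP.1 z z; rewrite orbb.
have /andP[xy nyx] := gt_cons_geP N0T hxy.
have /andP[xy' nyx'] := gt_cons_geP N0T hxy'.
(* Both sides become [N (B :|: ~: A) <= N (A :|: ~: B)]. *)
by rewrite /ge_act !ge_set_omega.
Qed.
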